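(* Let $(\Omega,\mathcal F)$ be a measurable space and let $\mathcal P\subset\mathcal M_1$ be nonempty. Every $\mu\in\mathcal P_{\mathrm{eff}}$ is setwise dominated by some maximal element $\mu'\in\mathcal P_{\mathrm{eff}}$ (maximal with respect to the setwise ordering). Every such maximal element $\mu'$ is the countably additive part of some $\mu''\in\overline{\mathrm{co}}^*(\mathcal P)$. As a consequence, $\mathcal P_{\mathrm{eff}}$ is the solid hull of the set of countably additive parts of elements of $\overline{\mathrm{co}}^*(\mathcal P)$.
   Context: $\mathcal M_1$ (resp. $\mathcal M_+$) is the set of countably additive probability (resp. finite nonnegative) measures on $(\Omega,\mathcal F)$. An e-variable for $\mathcal P$ is a measurable function $Z:\Omega\to[0,\infty]$ with $\mathbb E_\mu[Z]\le1$ for all $\mu\in\mathcal P$; $\mathcal E$ is the set of all e-variables for $\mathcal P$. The effective null hypothesis is $\mathcal P_{\mathrm{eff}}=\{\mu\in\mathcal M_+:\mathbb E_\mu[Z]\le1\text{ for all }Z\in\mathcal E\}$. $\mathsf{ba}$ is the space of bounded finitely additive real-valued set functions on $\mathcal F$ (bounded in total variation), and $\mathsf{ba}_+$ its nonnegative elements. The setwise ordering is $\mu\le\nu$ iff $\mu(A)\le\nu(A)$ for all $A\in\mathcal F$. Every $\mu\in\mathsf{ba}_+$ has a unique (Yosida–Hewitt) decomposition $\mu=\mu_c+\mu_p$ with $\mu_c\in\mathcal M_+$ (the countably additive part) and $\mu_p\in\mathsf{ba}_+$ purely finitely additive, meaning that any countably additive $\nu$ with $0\le\nu\le\mu_p$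 is $0$. The weak-$*$ topology on $\mathsf{ba}$ is the weakest one making $\mu\mapsto\int f\,d\mu$ continuous for all bounded measurable $f:\Omega\to\mathbb R$ (integral of simple functions extended by uniform limits). $\overline{\mathrm{co}}^*(\mathcal P)$ is the weak-$*$ closure in $\mathsf{ba}$ of the convex hull of $\mathcal P$. The solid hull of $\mathcal A\subset\mathcal M_+$ is $\{\mu\in\mathcal M_+:\mu\le\nu\text{ for some }\nu\in\mathcal A\}$. *)

(* Defs.v *)
From HB Require Import structures.
From mathcomp Require Import all_boot all_order all_algebra.
From mathcomp Require Import all_classical all_reals all_analysis measurable_realfun.

Set Implicit Arguments.
Unset Strict Implicit.
Unset Printing Implicit Defensive.

Import Order.TTheory GRing.Theory Num.Theory.
Import numFieldNormedType.Exports.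
Import HBSimple.

Local Open Scope classical_set_scope.
Local Open Scope ring_scope.
Local Open Scope ereal_scope.

(* Set functions are total on [set Omega]; their values outside [measurable]
   are irrelevant, so every comparison is restricted to measurable sets. *)
Section setwise_order.
Context (d : measure_display) (Omega : measurableType d) (R : realType).

Definition setwise_le (mu nu : set Omega -> \bar R) : Prop :=
  forall A, measurable A -> mu A <= nu A.

Definition setwise_eq (mu nu : set Omega -> \bar R) : Prop :=
  forall A, measurable A -> mu A = nu A.

Definition solid_hull (A : set {finite_measure set Omega -> \bar R}) :
    set {finite_measure set Omega -> \bar R} :=
  [set mu | exists2 nu, A nu & setwise_le mu nu].

End setwise_order.

Section effective_null.
Context (d : measure_display) (Omega : measurableType d) (R : realType).
Variable P : set (probability Omega R).

Definition e_variable (Z : Omega -> \bar R) : Prop :=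
  [/\ measurable_fun setT Z,
      forall x, 0 <= Z x
    & forall mu, P mu -> \int[mu]_x Z x <= 1].

Definition effective_null : set {finite_measure set Omega -> \bar R} :=
  [set mu | forall Z, e_variable Z -> \int[mu]_x Z x <= 1].

Definition maximal_effective_null : set {finite_measure set Omega -> \bar R} :=
  [set mu | effective_null mu /\
    forall nu, effective_null nu -> setwise_le mu nu -> setwise_eq nu mu].

End effective_null.

(* [{additive_charge set Omega -> \bar R}] is finitely additive with finite
   (real) values on measurable sets, but is not bounded in general. *)
Definition bounded_total_variation (d : measure_display)
    (Omega : measurableType d) (R : realType) (mu : set Omega -> \bar R) : Prop :=
  exists M : R, forall (n : nat) (A : nat -> set Omega),
    (forall i, measurable (A i)) -> trivIset setT A ->
    \sum_(i < n) `|mu (A i)| <= M%:E.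

Record ba (d : measure_display) (Omega : measurableType d) (R : realType) :=
  Ba {
    ba_charge :> {additive_charge set Omega -> \bar R};
    ba_bounded : bounded_total_variation ba_charge }.

(* The integral of a bounded measurable [f] is the common limit of the
   integrals of simple functions converging uniformly to [f]. *)
Definition ba_integral (d : measure_display) (Omega : measurableType d)
    (R : realType) (mu : ba Omega R) (f : Omega -> R) : R :=
  get [set I : R | forall g : nat -> {sfun Omega >-> R},
    {uniform, (fun n => g n : Omega -> R) @ \oo --> f} ->
    sintegral mu (g n) @[n --> \oo] --> I%:E].

Definition bounded_mfun (d : measure_display) (Omega : measurableType d)
    (R : realType) : Type :=
  {f : {mfun Omega >-> R} | bounded_fun f}.

HB.instance Definition _ (d : measure_display) (Omega : measurableType d)
  (R : realType) := gen_eqMixin (ba Omega R).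
HB.instance Definition _ (d : measure_display) (Omega : measurableType d)
  (R : realType) := gen_choiceMixin (ba Omega R).

(* The supremum of the initial topologies is the weak-* topology; it is not
   separated, since it ignores the values outside [measurable]. *)
HB.instance Definition _ (d : measure_display) (Omega : measurableType d)
    (R : realType) :=
  Topological.copy (ba Omega R)
    (sup_topology (fun f : bounded_mfun Omega R =>
      Topological.on (initial_topology
        (fun mu : ba Omega R => ba_integral mu (sval f) : R)))).

Section countably_additive_part.
Context (d : measure_display) (Omega : measurableType d) (R : realType).

Definition ba_nonneg (mu : ba Omega R) : Prop :=
  forall A, measurable A -> 0 <= mu A.

Definition purely_finitely_additive (mu : ba Omega R) : Prop :=
  forall nu : {finite_measure set Omega -> \bar R},
    setwise_le nu mu -> setwise_eq nu (cst 0).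

(* A relation, because the countably additive part is determined (by the
   uniqueness of the Yosida-Hewitt decomposition) only on measurable sets. *)
Definition is_countably_additive_part (mu : ba Omega R)
    (nu : {finite_measure set Omega -> \bar R}) : Prop :=
  exists mu_p : ba Omega R,
    [/\ ba_nonneg mu_p, purely_finitely_additive mu_p
      & setwise_eq mu (fun A => nu A + mu_p A)].

Definition countably_additive_parts (C : set (ba Omega R)) :
    set {finite_measure set Omega -> \bar R} :=
  [set nu | exists2 mu, C mu & is_countably_additive_part mu nu].

Definition convex_hull (P : set (probability Omega R)) : set (ba Omega R) :=
  [set mu | exists (n : nat) (w : 'I_n -> R) (p : 'I_n -> probability Omega R),
    [/\ forall i, (0 <= w i)%R,
        (\sum_(i < n) w i)%R = 1%R,
        forall i, P (p i)
      & setwise_eq mu (fun A => \sum_(i < n) (w i)%:E * p i A)]].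

Definition closed_convex_hull (P : set (probability Omega R)) :
    set (ba Omega R) :=
  closure (convex_hull P).

End countably_additive_part.

(* Main.v *)
Require Import Defs.
From HB Require Import structures.
From mathcomp Require Import all_boot all_order all_algebra.
From mathcomp Require Import all_classical all_reals all_analysis measurable_realfun.
From mathcomp Require Import ring lra.
From mathcomp Require finmap.

(* A finite measure [mu] is in the effective null exactly when it is setwise
   dominated by an element of the closed convex hull.  If it is in the effective
   null, then [mu g <= s g := sup_(p in P) p g] for simple [g >= 0], since [g / c]
   is an e-variable for [c > s g]; the Hahn-Banach theorem, applied to
   [f |-> inf_(g >= 0) (s (f + g) - mu g)], gives a linear [L <= s] with [mu <= L],
   and a functional below [s] is a weak-* limit of convex combinations of [P].
   Conversely, the bound [p g <= 1] for simple [g <= Z] survives weak-* limits.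

   If moreover [mu] is maximal and [mu <= nu] with [nu] in the closed convex hull,
   then [nu - mu] is purely finitely additive: a countably additive
   [kappa <= nu - mu] gives [mu + kappa <= nu], so [mu + kappa] is in the
   effective null and [kappa = 0] by maximality. *)

Set Implicit Arguments.
Unset Strict Implicit.
Unset Printing Implicit Defensive.

Import Order.TTheory GRing.Theory Num.Theory.
Import numFieldNormedType.Exports.
Import HBSimple.

Local Open Scope classical_set_scope.
Local Open Scope ring_scope.

(** * The Hahn-Banach theorem *)

Section hahn_banach.
Context (R : realType) (V : lmodType R).
Implicit Types (p q : V -> R) (x y : V).

Definition sublinear p :=
  (forall x y, p (x + y) <= p x + p y) /\
  (forall t x, 0 <= t -> p (t *: x) = t * p x).

Lemma sublinear0 p : sublinear p -> p 0 = 0.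
Proof. by move=> [_ /(_ 0 0 (lexx _))]; rewrite scale0r mul0r. Qed.

Lemma sublinear_ge p x : sublinear p -> - p (- x) <= p x.
Proof.
move=> sp; have := sp.1 x (- x).
by rewrite subrr sublinear0// => H; rewrite -subr_ge0 opprK.
Qed.

Lemma inf_le (A : set R) (b x : R) : lbound A b -> A x -> inf A <= x.
Proof. by move=> Ab Ax; apply: ge_inf => //; exists b. Qed.

Section infconv.
Variables (p : V -> R) (K : set (V * R)).
Hypotheses (sp : sublinear p) (K0 : K (0, 0)).
Hypothesis KD : forall u v, K u -> K v -> K (u.1 + v.1, u.2 + v.2).
Hypothesis KZ : forall t u, 0 <= t -> K u -> K (t *: u.1, t * u.2).
Hypothesis Kle : forall u, K u -> u.2 <= p u.1.

(** [K] is a convex cone of constraints. A linear [L] below [infconv] is below [p], and the bound of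
    [infconv_le] at [x = - u.1] forces [u.2 <= L u.1] for every [u] in [K]. *)
Definition infconv x := inf [set p (x + u.1) - u.2 | u in K].

(** Subadditivity gives [u.2 <= p u.1 <= p (x + u.1) + p (- x)], so the infimum is a genuine one and
    not the default value of [inf]. *)
Let lb x : lbound [set p (x + u.1) - u.2 | u in K] (- p (- x)).
Proof.
move=> _ [u Ku <-]; have := Kle Ku; have := sp.1 (x + u.1) (- x).
rewrite addrAC subrr add0r; lra.
Qed.

Let ne x : [set p (x + u.1) - u.2 | u in K] !=set0.
Proof. by exists (p (x + 0) - 0), (0, 0). Qed.

Lemma infconv_le x u : K u -> infconv x <= p (x + u.1) - u.2.
Proof. by move=> Ku; apply: (@inf_le _ (- p (- x))) => //; exists u. Qed.

Lemma le_infconv x b : (forall u, K u -> b <= p (x + u.1) - u.2) ->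
  b <= infconv x.
Proof.
by move=> bK; apply: lb_le_inf; [exact: ne|move=> _ [u Ku <-]; exact: bK].
Qed.

Lemma infconv_lep x : infconv x <= p x.
Proof. by have := infconv_le x K0; rewrite /= addr0 subr0. Qed.

Let infconvZ_ge t x : 0 < t -> t * infconv x <= infconv (t *: x).
Proof.
move=> t0; apply: le_infconv => u Ku.
have Ku' := KZ (ltW (etrans (invr_gt0 t) t0)) Ku.
have := infconv_le x Ku'; rewrite /= -(ler_pM2l t0) => /le_trans; apply.
rewrite mulrBr -sp.2 ?(ltW t0)// scalerDr scalerA mulrA divff ?gt_eqF//.
by rewrite scale1r mul1r.
Qed.

Lemma infconv_sublinear : sublinear infconv.
Proof.
split=> [x y|t x].
  rewrite -lerBlDr; apply: le_infconv => u Ku.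
  rewrite lerBlDr -lerBlDl; apply: le_infconv => v Kv.
  have := infconv_le (x + y) (KD Ku Kv); have := sp.1 (x + u.1) (y + v.1).
  rewrite /= addrACA; lra.
rewrite le_eqVlt => /predU1P[<-|t0].
  rewrite scale0r mul0r; apply/le_anti/andP; split.
    by rewrite (le_trans (infconv_lep _))// sublinear0.
  by apply: le_infconv => u Ku; rewrite add0r subr_ge0 Kle.
apply/le_anti; rewrite infconvZ_ge// andbT.
(* The reverse inequality is the same one for the factor [t^-1] at the point [t *: x]. *)
have := @infconvZ_ge t^-1 (t *: x); rewrite invr_gt0 => /(_ t0).
by rewrite scalerA mulVf ?gt_eqF// scale1r ler_pdivrMl.
Qed.

End infconv.

(** For subadditivity, the infima at [x] and [y] may be approached by different members [q] and [r];
    in a chain the smaller of the two serves at both points. The common bound [p] keeps the values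
    at [x] above [- p (- x)]. *)
Lemma chain_inf_sublinear (C : set (V -> R)) p :
  C !=set0 -> (forall q, C q -> sublinear q /\ forall x, q x <= p x) ->
  (forall q r, C q -> C r -> (forall x, q x <= r x) \/ (forall x, r x <= q x)) ->
  sublinear (fun x => inf [set q x | q in C]) /\
  forall q x, C q -> inf [set q x | q in C] <= q x.
Proof.
move=> [q0 Cq0] Cs Ct.
have lb x : lbound [set q x | q in C] (- p (- x)).
  move=> _ [q Cq <-]; have [sq qp] := Cs q Cq.
  by rewrite (le_trans _ (sublinear_ge x sq))// lerN2.
have ne x : [set q x | q in C] !=set0 by exists (q0 x), q0.
have le q x : C q -> inf [set q x | q in C] <= q x.
  by move=> Cq; apply: (@inf_le _ (- p (- x))) => //; exists q.
split=> //; split=> [x y|t x].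
  rewrite -lerBlDr; apply: lb_le_inf; [exact: ne|move=> _ [q Cq <-]].
  rewrite lerBlDr -lerBlDl; apply: lb_le_inf; [exact: ne|move=> _ [r Cr <-]].
  rewrite lerBlDr.
  have [qr|rq] := Ct q r Cq Cr.
    rewrite (le_trans (le q _ Cq))// (le_trans ((Cs q Cq).1.1 x y))//.
    by rewrite addrC lerD.
  rewrite (le_trans (le r _ Cr))// (le_trans ((Cs r Cr).1.1 x y))//.
  by rewrite addrC lerD.
rewrite le_eqVlt => /predU1P[<-|t0].
  rewrite scale0r mul0r; apply/le_anti/andP; split.
    by rewrite (le_trans (le q0 _ Cq0))// sublinear0//; exact: (Cs q0 Cq0).1.
  apply: lb_le_inf; [exact: ne|move=> _ [q Cq <-]].
  by rewrite sublinear0//; exact: (Cs q Cq).1.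
apply/le_anti/andP; split.
  rewrite -ler_pdivrMl//; apply: lb_le_inf; [exact: ne|move=> _ [q Cq <-]].
  rewrite ler_pdivrMl// (le_trans (le q _ Cq))// (Cs q Cq).1.2//; exact: ltW.
apply: lb_le_inf; [exact: ne|move=> _ [q Cq <-]].
by rewrite (Cs q Cq).1.2 ?(ltW t0)// ler_pM2l// le.
Qed.

(* A sublinear functional that is minimal for the pointwise order is linear:
   otherwise [infconv] along the ray through [y] would lower it. *)
Theorem hahn_banach p : sublinear p ->
  exists L : V -> R, [/\ forall x y, L (x + y) = L x + L y,
    forall t x, L (t *: x) = t * L x & forall x, L x <= p x].
Proof.
move=> sp.
pose S := {q : V -> R | sublinear q /\ forall x, q x <= p x}.
(* The order is reversed, so that a premaximal element for [D] is pointwise minimal. *)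
pose D : rel S := fun u w : S => `[< forall x, sval w x <= sval u x >].
have pS : sublinear p /\ forall x, p x <= p x by [].
have [q qmin] : exists q : S, premaximal D q.
  apply: (@ZL_preorder S (exist _ p pS)).
  - by move=> q; apply/asboolP.
  - move=> r q t /asboolP rq /asboolP qt; apply/asboolP => x.
    exact: le_trans (qt x) (rq x).
  - move=> A Atot.
    have [A0|/set0P[q0 Aq0]] := eqVneq A set0.
      by exists (exist _ p pS) => r; rewrite A0.
    pose C := [set sval q | q in A].
    have Cs q : C q -> sublinear q /\ forall x, q x <= p x.
      by move=> [r _ <-]; exact: (svalP r).
    have Ct q r : C q -> C r ->
        (forall x, q x <= r x) \/ (forall x, r x <= q x).
      move=> [q' Aq' <-] [r' Ar' <-].
      by have [/asboolP|/asboolP] := Atot _ _ Aq' Ar'; [right|left].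
    have C0 : C !=set0 by exists (sval q0), q0.
    have [sI leI] := chain_inf_sublinear C0 Cs Ct.
    have Ip x : inf [set q x | q in C] <= p x.
      by rewrite (le_trans (leI (sval q0) x _))//; [exists q0|exact: (svalP q0).2].
    pose I0 : S := exist _ (fun x => inf [set q x | q in C]) (conj sI Ip).
    exists I0 => q Aq; apply/asboolP => x /=.
    by apply: leI; exists q.
case: q qmin => q [sq qp] /= qmin.
have qD x y : q x + q y <= q (x + y).
  pose K := [set u : V * R | exists2 t, 0 <= t & u = (t *: y, t * q y)].
  have K0 : K (0, 0) by exists 0; rewrite ?scale0r ?mul0r.
  have KD u v : K u -> K v -> K (u.1 + v.1, u.2 + v.2).
    move=> [t t0 ->] [t' t'0 ->]; exists (t + t'); first exact: addr_ge0.
    by rewrite scalerDl mulrDl.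
  have KZ t u : 0 <= t -> K u -> K (t *: u.1, t * u.2).
    move=> t0 [t' t'0 ->]; exists (t * t'); first exact: mulr_ge0.
    by rewrite scalerA mulrA.
  have Kle u : K u -> u.2 <= q u.1 by move=> [t t0 ->] /=; rewrite sq.2.
  have sI := infconv_sublinear sq K0 KD KZ Kle.
  have Iq := infconv_lep sq K0 Kle.
  have Ip z : infconv q K z <= p z by rewrite (le_trans (Iq z)).
  pose I0 : S := exist _ (infconv q K) (conj sI Ip).
  (* Minimality gives [q x <= infconv q K x], and the point [t = 1] of the ray gives
     [infconv q K x <= q (x + y) - q y]. *)
  have := qmin I0.
  rewrite /D /= => /(_ (asboolT Iq)) /asboolP /(_ x).
  have K1 : K (y, q y) by exists 1; rewrite ?scale1r ?mul1r.
  have := infconv_le sq Kle x K1 => /=; lra.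
have qDE x y : q (x + y) = q x + q y by apply/le_anti; rewrite sq.1 qD.
have qN x : q (- x) = - q x.
  by apply/eqP; rewrite -addr_eq0 -qDE addNr sublinear0.
exists q; split => // t x; have [t0|/ltW t0] := leP 0 t; first exact: sq.2.
by rewrite -[t *: x]opprK -scaleNr qN sq.2 ?oppr_ge0// mulNr opprK.
Qed.

End hahn_banach.

(** * Integrals of simple functions against contents *)

Section sfun_lmodule.
Context (d : measure_display) (Omega : measurableType d) (R : realType).

(** Scalars act through constant simple functions. The resulting module is the space to which
    [hahn_banach] is applied. *)
Let scale (k : R) (f : {sfun Omega >-> R}) : {sfun Omega >-> R} :=
  cst_sfun k * f.

Let scaleA a b f : scale a (scale b f) = scale (a * b) f.
Proof. by apply/sfuneqP => x; rewrite /scale !sfunM /= mulrA. Qed.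

Let scale1 : left_id 1 scale.
Proof. by move=> f; apply/sfuneqP => x; rewrite /scale !sfunM /= mul1r. Qed.

Let scaleDr : right_distributive scale +%R.
Proof. by move=> a f g; rewrite /scale mulrDr. Qed.

Let scaleDl f : {morph scale^~ f : a b / a + b}.
Proof.
by move=> a b; apply/sfuneqP => x; rewrite /scale !(sfunM, sfunD) /= mulrDl.
Qed.

HB.instance Definition _ := GRing.Zmodule_isLmodule.Build R
  {sfun Omega >-> R} scaleA scale1 scaleDr scaleDl.

Lemma sfunZ (k : R) (f : {sfun Omega >-> R}) x : (k *: f) x = k * f x.
Proof. by []. Qed.

End sfun_lmodule.

Section indic_sfun.
Context (d : measure_display) (Omega : measurableType d) (R : realType).
Variables (A : set Omega) (mA : measurable A).

Lemma indic_sfunE x : indic_sfun A mA x = (x \in A)%:R :> R.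
Proof. by rewrite /indic_sfun mindicE. Qed.

Lemma indic_sfun1 x : A x -> indic_sfun A mA x = 1 :> R.
Proof. by move=> Ax; rewrite indic_sfunE mem_set. Qed.

Lemma indic_sfun0 x : ~ A x -> indic_sfun A mA x = 0 :> R.
Proof. by move=> Ax; rewrite indic_sfunE memNset. Qed.

Lemma indic_sfun_ge0 x : 0 <= indic_sfun A mA x :> R.
Proof. by rewrite indic_sfunE ler0n. Qed.

End indic_sfun.

Section finitely_additive.
Context (d : measure_display) (Omega : measurableType d) (R : realType).
Implicit Types (m : set Omega -> R) (f g h : {sfun Omega >-> R}).

Definition finitely_additive m := forall A B, measurable A -> measurable B ->
  A `&` B = set0 -> m (A `|` B) = m A + m B.

Lemma finitely_additive0 m : finitely_additive m -> m set0 = 0.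
Proof.
move=> /(_ _ _ measurable0 measurable0 (setI0 _)); rewrite setU0; lra.
Qed.

Lemma finitely_additive_preimage m (T : eqType) (k : Omega -> T) (s : seq T) :
  finitely_additive m -> uniq s ->
  (forall t, measurable (k @^-1` [set t])) ->
  measurable (k @^-1` [set` s]) /\
  m (k @^-1` [set` s]) = \sum_(t <- s) m (k @^-1` [set t]).
Proof.
move=> madd + mk; elim: s => [_|t s IH /= /andP[ts us]].
  by rewrite set_nil preimage_set0 big_nil; split=> //; exact: finitely_additive0.
have [ms IHs] := IH us.
have -> : k @^-1` [set` t :: s] = k @^-1` [set t] `|` k @^-1` [set` s].
  apply/seteqP; split => w /=; rewrite in_cons.
    by case/predU1P => ?; [left|right].
  by case=> [->|->]; rewrite ?eqxx ?orbT.
split; first exact: measurableU.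
rewrite madd// ?big_cons ?IHs// -subset0 => x /= [kx]; rewrite kx => ts'.
by rewrite ts' in ts.
Qed.

(** A real-valued counterpart of [sintegral], which keeps linear arithmetic out of the extended
    reals; [sintegral_fine] relates the two. *)
Definition sfun_integral m f : R :=
  \sum_(x <- finmap.enum_fset (fset_set (range f))) x * m (f @^-1` [set x]).

(** The integral can be computed on any finite partition into fibers of [k] on which [f] is
    constant: grouping the fibers by the value of [f] gives back the definition. *)
Lemma sfun_integral_comp m (T : choiceType) (k : Omega -> T) (s : seq T)
    (phi : T -> R) f : finitely_additive m -> uniq s ->
  (forall t, measurable (k @^-1` [set t])) -> (forall x, k x \in s) ->
  (forall x, f x = phi (k x)) ->
  sfun_integral m f = \sum_(t <- s) phi t * m (k @^-1` [set t]).
Proof.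
move=> madd us mk ks fE; rewrite /sfun_integral.
set r := finmap.enum_fset _.
have rE x : (x \in r) = (x \in range f).
  by rewrite in_fset_set//; exact: fimfunP.
transitivity (\sum_(x <- r) \sum_(t <- s | phi t == x) phi t * m (k @^-1` [set t])).
  apply: eq_bigr => x _.
  have -> : f @^-1` [set x] = k @^-1` [set` [seq t <- s | phi t == x]].
    apply/seteqP; split => w /=; rewrite mem_filter ks andbT fE.
      by move=> ->.
    by move/eqP.
  have us' := filter_uniq (fun t => phi t == x) us.
  have [_ ->] := finitely_additive_preimage madd us' mk.
  rewrite big_filter big_distrr; apply: eq_bigr => t /eqP ->//.
(* A [t] in [s] with [phi t] outside the range of [f] is not attained by [k], so its fiber is
   empty. *)
have dead t : phi t \notin r -> m (k @^-1` [set t]) = 0.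
  move=> tr; rewrite (_ : _ @^-1` _ = set0) ?finitely_additive0//.
  rewrite -subset0 => w /= kw; move: tr; rewrite rE -kw -fE => /negP; apply.
  by rewrite inE; exists w.
rewrite (exchange_big_dep xpredT)//=; apply: eq_bigr => t _.
have [tr|tr] := boolP (phi t \in r); last first.
  by rewrite dead// mulr0 big1.
rewrite (big_rem (phi t))//= eqxx big1_seq ?addr0// => x /andP[/eqP <-].
by rewrite mem_rem_uniq ?finmap.fset_uniq// inE eqxx.
Qed.

Lemma measurable_sfun_fiber f x : measurable (f @^-1` [set x]).
Proof. exact: measurable_sfunP. Qed.

Section linearity.
Variables (m : set Omega -> R) (madd : finitely_additive m).

(** The fibers of the pair [(f, g)] form a common refinement on which [f], [g] and [h] are all
    constant; linearity then holds term by term. *)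
Lemma sfun_integral_comp2 (phi : R -> R -> R) f g h :
  (forall x, h x = phi (f x) (g x)) ->
  sfun_integral m h =
  \sum_(t <- [seq (x, y) | x <- finmap.enum_fset (fset_set (range f)),
                           y <- finmap.enum_fset (fset_set (range g))])
    phi t.1 t.2 * m ((fun w => (f w, g w)) @^-1` [set t]).
Proof.
move=> hE; apply: (sfun_integral_comp (phi := fun t => phi t.1 t.2)) => //.
- by apply: allpairs_uniq => [||[? ?] [? ?]//]; exact: finmap.fset_uniq.
- move=> [x y]; rewrite (_ : _ @^-1` _ = f @^-1` [set x] `&` g @^-1` [set y]).
    by apply: measurableI; exact: measurable_sfun_fiber.
  by apply/seteqP; split => w /=; [case=> -> ->|case=> -> ->].
- move=> w; apply: allpairs_f; rewrite in_fset_set ?inE; try exact: fimfunP;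
    by exists w.
Qed.

Lemma sfun_integralD f g :
  sfun_integral m (f + g) = sfun_integral m f + sfun_integral m g.
Proof.
rewrite (@sfun_integral_comp2 (fun x y => x + y) f g)//.
rewrite (@sfun_integral_comp2 (fun x y => x) f g f)//.
rewrite (@sfun_integral_comp2 (fun x y => y) f g g)//.
by rewrite -big_split/=; apply: eq_bigr => t _; rewrite mulrDl.
Qed.

Lemma sfun_integralZ k f :
  sfun_integral m (k *: f) = k * sfun_integral m f.
Proof.
rewrite (@sfun_integral_comp2 (fun x y => k * x) f f)//.
rewrite (@sfun_integral_comp2 (fun x y => x) f f f)//.
by rewrite big_distrr/=; apply: eq_bigr => t _; rewrite mulrA.
Qed.

Lemma sfun_integralN f : sfun_integral m (- f) = - sfun_integral m f.
Proof. by rewrite -scaleN1r sfun_integralZ mulN1r. Qed.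

Lemma sfun_integralB f g :
  sfun_integral m (f - g) = sfun_integral m f - sfun_integral m g.
Proof. by rewrite sfun_integralD sfun_integralN. Qed.

Lemma sfun_integral_cst k :
  sfun_integral m (cst_sfun k) = k * m setT.
Proof.
rewrite (@sfun_integral_comp m unit (fun=> tt) [:: tt] (fun=> k))//.
- by rewrite big_seq1; congr (_ * m _); apply/seteqP; split => // w _; case: (tt).
- by case; rewrite (_ : _ @^-1` _ = setT)//; apply/seteqP; split.
Qed.

Lemma sfun_integral_indic (A : set Omega) (mA : measurable A) :
  sfun_integral m (indic_sfun A mA) = m A.
Proof.
rewrite (@sfun_integral_comp m bool (fun w => w \in A) [:: true; false]
  (fun b => b%:R))//.
- rewrite big_cons big_seq1 mul0r addr0 mul1r; congr m.
  by apply/seteqP; split => w /=; [move/set_mem|move/mem_set].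
- have AE : (fun w => w \in A) @^-1` [set true] = A.
    by apply/seteqP; split => w /=; [move/set_mem|move/mem_set].
  case; first by rewrite AE.
  rewrite (_ : _ @^-1` _ = ~` A); first exact: measurableC.
  apply/seteqP; split => w /=; first by move/negbT; rewrite notin_setE.
  by move=> Aw; apply/negbTE; rewrite notin_setE.
- by move=> w; rewrite !inE; case: (_ \in _).
Qed.

Lemma sfun_integral_ge0 f : (forall A, measurable A -> 0 <= m A) ->
  (forall x, 0 <= f x) -> 0 <= sfun_integral m f.
Proof.
move=> m0 f0; rewrite /sfun_integral big_seq; apply: sumr_ge0 => x.
rewrite in_fset_set; last exact: fimfunP.
rewrite inE => -[w _ <-]; apply: mulr_ge0 => //.
exact/m0/measurable_sfun_fiber.
Qed.

Lemma le_sfun_integral f g : (forall A, measurable A -> 0 <= m A) ->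
  (forall x, f x <= g x) -> sfun_integral m f <= sfun_integral m g.
Proof.
move=> m0 fg; rewrite -subr_ge0 -sfun_integralB; apply: sfun_integral_ge0 => //.
by move=> x; rewrite sfunB/= subr_ge0.
Qed.

End linearity.

Lemma le_sfun_integral_content m1 m2 f :
  (forall A, measurable A -> m1 A <= m2 A) -> (forall x, 0 <= f x) ->
  sfun_integral m1 f <= sfun_integral m2 f.
Proof.
move=> m12 f0; rewrite /sfun_integral !big_seq; apply: ler_sum => x.
rewrite in_fset_set; last exact: fimfunP.
rewrite inE => -[w _ <-]; apply: ler_wpM2l => //.
exact/m12/measurable_sfun_fiber.
Qed.

Definition variation_at_most m M := forall n (A : nat -> set Omega),
  (forall i, measurable (A i)) -> trivIset setT A ->
  \sum_(i < n) `|m (A i)| <= M.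

Lemma variation_at_most_ge0 m M : variation_at_most m M -> 0 <= M.
Proof.
move=> /(_ 0%N (fun=> set0)); rewrite big_ord0; apply=> //.
exact: trivIset_set0.
Qed.

Lemma sfun_integral_bound m M f e : finitely_additive m -> variation_at_most m M ->
  0 <= e -> (forall x, `|f x| <= e) -> `|sfun_integral m f| <= e * M.
Proof.
move=> madd mM e0 fe; rewrite /sfun_integral.
set r := finmap.enum_fset _.
have rE x : (x \in r) = (x \in range f).
  by rewrite in_fset_set//; exact: fimfunP.
(* The finitely many fibers are padded with empty sets into the disjoint sequence that
   [variation_at_most] expects. *)
pose A i := if (i < size r)%N then f @^-1` [set nth 0 r i] else set0.
have mA i : measurable (A i).
  by rewrite /A; case: ifP => // _; exact: measurable_sfun_fiber.
have tA : trivIset setT A.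
  apply/trivIsetP => i j _ _ ij; rewrite /A.
  case: ifP => ir; last by rewrite set0I.
  case: ifP => jr; last by rewrite setI0.
  rewrite -subset0 => w /= [-> /eqP].
  by rewrite nth_uniq ?finmap.fset_uniq// (negbTE ij).
apply: (le_trans (ler_norm_sum _ _ _)).
rewrite (big_nth 0) big_mkord.
apply: le_trans (ler_wpM2l e0 (mM (size r) A mA tA)).
rewrite mulr_sumr; apply: ler_sum => i _; rewrite normrM /A ltn_ord.
apply: ler_wpM2r => //.
by have := mem_nth 0 (ltn_ord i); rewrite rE inE => -[w _ <-].
Qed.

Lemma finitely_additive_bigsetU m n (A : nat -> set Omega) :
  finitely_additive m -> (forall i, measurable (A i)) -> trivIset setT A ->
  m (\big[setU/set0]_(i < n) A i) = \sum_(i < n) m (A i).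
Proof.
move=> madd mA tA; elim: n => [|n IH].
  by rewrite !big_ord0 finitely_additive0.
rewrite !big_ord_recr/= madd//; first by rewrite IH.
  exact: bigsetU_measurable.
rewrite -subset0 => w [/=]; rewrite -bigcup_mkord => -[i /= ni Aiw] Anw.
move/trivIsetP : tA => /(_ i n Logic.I Logic.I).
rewrite neq_ltn ni => /(_ isT) Ain.
by have : (A i `&` A n) w by []; rewrite Ain.
Qed.

(** For a nonnegative content, the sum over disjoint sets is the content of their union, which is at
    most the total mass. *)
Lemma variation_at_most_mass m : finitely_additive m ->
  (forall A, measurable A -> 0 <= m A) -> variation_at_most m (m setT).
Proof.
move=> madd m0 n A mA tA.
have mU : measurable (\big[setU/set0]_(i < n) A i) by exact: bigsetU_measurable.
rewrite (eq_bigr (fun i : 'I_n => m (A i))); last first.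
  by move=> i _; rewrite ger0_norm ?m0.
rewrite -(finitely_additive_bigsetU n madd mA tA).
have mC := measurableC mU.
rewrite -[in leRHS](setvU (\big[setU/set0]_(i < n) A i)) madd//; last exact: setICl.
by rewrite lerDr m0.
Qed.

Lemma eq_sfun_integral m1 m2 f : (forall A, measurable A -> m1 A = m2 A) ->
  sfun_integral m1 f = sfun_integral m2 f.
Proof.
by move=> m12; apply: eq_bigr => x _; rewrite m12//; exact: measurable_sfun_fiber.
Qed.

Lemma sfun_integral_lincomb n (w : 'I_n -> R) (m : 'I_n -> set Omega -> R) f :
  sfun_integral (fun A => \sum_(i < n) w i * m i A) f =
  \sum_(i < n) w i * sfun_integral (m i) f.
Proof.
rewrite /sfun_integral; under [RHS]eq_bigr do rewrite mulr_sumr.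
rewrite exchange_big; apply: eq_bigr => x _ /=.
by rewrite mulr_sumr; apply: eq_bigr => i _; rewrite mulrCA.
Qed.

Lemma sintegral_fine (nu : set Omega -> \bar R) f :
  nu set0 = 0%E -> (forall A, measurable A -> nu A \is a fin_num) ->
  sintegral nu f = (sfun_integral (fine \o nu) f)%:E.
Proof.
move=> nu0 nufin; rewrite /sintegral -(fsbig_widen (range f) setT)//=; last first.
  by move=> x [_ Nfx] /=; rewrite preimage10// nu0 mule0.
rewrite fsbig_finite//=.
rewrite /sfun_integral -sumEFin; apply: eq_bigr => x _.
by rewrite EFinM fineK// nufin//; exact: measurable_sfun_fiber.
Qed.

Lemma semi_additive_set0 (nu : set Omega -> \bar R) :
  measure_function.semi_additive nu -> nu set0 = 0%E.
Proof.
move=> /(_ (fun=> set0) 0%N (fun=> measurable0)); rewrite !big_ord0; apply => //.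
by apply/trivIsetP => i j _ _ _; rewrite setI0.
Qed.

Lemma finitely_additive_fine (nu : set Omega -> \bar R) :
  (forall A, measurable A -> nu A \is a fin_num) ->
  measure_function.semi_additive nu -> finitely_additive (fine \o nu).
Proof.
move=> nufin nuadd A B mA mB AB; have nu0 := semi_additive_set0 nuadd.
rewrite /comp (semi_additiveW nu0 nuadd)//; last exact: measurableU.
by rewrite fineD ?nufin.
Qed.

End finitely_additive.

(** * Integrals of bounded functions against bounded charges *)

Section ba_integral_theory.
Context (d : measure_display) (Omega : measurableType d) (R : realType).
Implicit Types (nu : ba Omega R) (e M : R) (g h : {sfun Omega >-> R}) (f : Omega -> R).

Lemma cvg_uniform_distP (g : nat -> Omega -> R) f :
  {uniform, g @ \oo --> f} <->
  (forall e, 0 < e -> \forall n \near \oo, forall x, `|f x - g n x| <= e).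
Proof.
split=> [gf e e0|gf P].
  have : nbhs (f : {uniform Omega -> R}) [set h | forall x, `|f x - h x| <= e].
    apply/uniform_nbhs; exists [set uv | ball uv.1 e uv.2]; split.
      by rewrite -entourage_ballE; exists e.
    by move=> h + x => /(_ x Logic.I); rewrite /ball/= => /ltW.
  by move/gf.
move=> /uniform_nbhs[E [/= entE EP]].
move: entE; rewrite -entourage_ballE => -[e /= e0 eE].
have e20 : 0 < e / 2 by rewrite divr_gt0.
have [N _ NP] := gf _ e20; exists N => // n /NP gfn; apply: EP => x _; apply: eE.
by rewrite /ball /= (le_lt_trans (gfn x))// ltr_pdivrMr// ltr_pMr// ltr1n.
Qed.

Lemma bounded_sfun_approx f e : measurable_fun setT f -> bounded_fun f ->
  0 < e -> exists g, forall x, `|f x - g x| <= e.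
Proof.
move=> mf bf e0.
have [M fM] : exists M : R, forall x, `|f x| <= M.
  have [M0 [_ HM]] := bf; exists (`|M0| + 1) => x.
  by apply: HM => //; rewrite (le_lt_trans (ler_norm _))// ltrDl.
have mA (a : R) : measurable [set x | a <= f x].
  have := mf measurableT _ (measurable_itv `[a, +oo[); rewrite setTI.
  by congr (measurable _); apply/seteqP; split => x /=; rewrite in_itv/= andbT.
(* [S N] rounds [f + M] down to a multiple of [e], capped at [N * e]. *)
pose S N : {sfun Omega >-> R} :=
  \sum_(i < N) e *: indic_sfun _ (mA (i.+1%:R * e - M)).
have indE n x : indic_sfun _ (mA (n.+1%:R * e - M)) x =
    ((n.+1%:R * e <= f x + M)%R%:R : R).
  rewrite /indic_sfun mindicE; congr ((nat_of_bool _)%:R); rewrite -lerBlDr.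
  case: leP => H; first exact: mem_set.
  by apply/negbTE; rewrite notin_setE/=; apply/negP; rewrite -ltNge.
(* The third clause drives the induction: once [f x + M] reaches [N.+1%:R * e], [S N x] sits at its
   cap, and the next indicator raises it by exactly [e]. *)
have SP N x : [/\ S N x <= f x + M, f x + M <= N.+1%:R * e -> f x + M - S N x <= e
    & N%:R * e <= f x + M -> S N x = N%:R * e].
  elim: N => [|N [IH1 IH2 IH3]].
    rewrite /S big_ord0 sfun0/= mul1r mul0r subr0; split => //.
    by have := fM x; rewrite ler_norml => /andP[]; lra.
  have SE : S N.+1 x = S N x + e * ((N.+1%:R * e <= f x + M)%R%:R : R).
    by rewrite -indE /S big_ord_recr.
  rewrite SE; have [H|H] := leP (N.+1%:R * e) (f x + M).
    rewrite mulr1n mulr1.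
    have -> : S N x = N%:R * e by apply: IH3; move: H; rewrite -natr1; lra.
    split; move: H; rewrite -!natr1; lra.
  by rewrite mulr0n mulr0 addr0; split => // _; apply: IH2; exact: ltW.
(* This [N] gives [f x + M <= M + M <= N.+1%:R * e], so the second clause of [SP] applies at every
   [x]. *)
pose N := `|Num.ceil ((M + M) / e)|%N.
exists (S N - cst_sfun M) => x.
have [S1 S2 _] := SP N x.
have : f x + M - S N x <= e.
  apply: S2; apply: (@le_trans _ _ (M + M)).
    by rewrite lerD2r; have := fM x; rewrite ler_norml => /andP[].
  rewrite -ler_pdivrMr//.
  apply: (le_trans (Num.Theory.ceil_ge _)).
  rewrite /N -natr1; apply: (@le_trans _ _ (`|Num.ceil ((M + M) / e)|%:~R)).
    by rewrite ler_int ler_norm.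
  by rewrite -abszE lerDl.
rewrite sfunB/= ler_norml; lra.
Qed.

Definition ba_real nu : set Omega -> R := fine \o nu.

Lemma ba_fin nu A : measurable A -> nu A \is a fin_num.
Proof. exact: fin_num_measure. Qed.

Lemma ba_add nu : finitely_additive (ba_real nu).
Proof.
apply: finitely_additive_fine; first exact: ba_fin.
exact: charge_semi_additive.
Qed.

Lemma ba_variation nu : exists M, variation_at_most (ba_real nu) M.
Proof.
have [M HM] := ba_bounded nu; exists M => n A mA tA.
rewrite -lee_fin (le_trans _ (HM n A mA tA))// -sumEFin.
apply: lee_sum => i _; rewrite -abse_EFin fineK//; exact: ba_fin.
Qed.

Lemma ba_sintegral nu g : sintegral nu g = (sfun_integral (ba_real nu) g)%:E.
Proof.
apply: sintegral_fine; last exact: ba_fin.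
exact/semi_additive_set0/charge_semi_additive.
Qed.

(** [ba_integral] is a [get], so the common limit must be shown to exist. The intervals of radius
    [e * M] around the integrals of simple functions within [e] of [f] pairwise meet, and the
    infimum of their right ends lies in all of them. *)
Lemma ba_integral_approx nu M f g e : variation_at_most (ba_real nu) M ->
  measurable_fun setT f -> bounded_fun f ->
  0 <= e -> (forall x, `|f x - g x| <= e) ->
  `|ba_integral nu f - sfun_integral (ba_real nu) g| <= e * M.
Proof.
move=> nuM mf bf.
have M0 := variation_at_most_ge0 nuM.
set I := sfun_integral (ba_real nu).
pose close g e := 0 <= e /\ forall x, `|f x - g x| <= e.
have IB g1 e1 g2 e2 : close g1 e1 -> close g2 e2 -> 
    I g1 - e1 * M <= I g2 + e2 * M.
  move=> [e10 c1] [e20 c2].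
  have : `|I (g1 - g2)| <= (e1 + e2) * M.
    apply: sfun_integral_bound => //; [exact: ba_add|exact: addr_ge0|move=> x].
    rewrite sfunB/= (_ : _ - _ = (f x - g2 x) - (f x - g1 x)); last lra.
    by rewrite (le_trans (ler_normB _ _))// addrC lerD.
  rewrite /I sfun_integralB; last exact: ba_add.
  by rewrite ler_norml => /andP[]; rewrite mulrDl; lra.
pose U := [set r | exists g e, close g e /\ r = I g + e * M].
have approx e1 : 0 < e1 -> exists g1, close g1 e1.
  move=> e0; have [g1 gP] := bounded_sfun_approx mf bf e0.
  by exists g1; split=> //; exact: ltW.
(* [l] lies within [e1 * M] of [I g1] as soon as [g1] is within [e1] of [f]. *)
pose l := inf U.
have lP g1 e1 : close g1 e1 -> `|l - I g1| <= e1 * M.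
  move=> c1; rewrite ler_distl; apply/andP; split.
    apply: lb_le_inf; first by exists (I g1 + e1 * M), g1, e1.
    by move=> _ [g2 [e2 [c2 ->]]]; exact: IB.
  apply: ge_inf; last by exists g1, e1.
  by exists (I g1 - e1 * M) => _ [g2 [e2 [c2 ->]]]; exact: IB.
have cvgl (gs : nat -> {sfun Omega >-> R}) :
    {uniform, (fun n => gs n : Omega -> R) @ \oo --> f} ->
    sintegral nu (gs n) @[n --> \oo] --> l%:E.
  move=> /cvg_uniform_distP gsf.
  under eq_fun do rewrite ba_sintegral.
  apply: cvg_EFin; first by near=> n.
  apply/cvgrPdist_le => e1 e10 /=.
  have M1 : 0 < M + 1 by rewrite ltr_wpDl.
  have e2 : 0 < e1 / (M + 1) by rewrite divr_gt0.
  near=> n.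
  apply: (le_trans (@lP (gs n) (e1 / (M + 1)) _)).
    by split; [exact: ltW|near: n; exact: gsf].
  rewrite -mulrA ger_pMr// mulrC ler_pdivrMr// mul1r lerDl//.
(* Some sequence of simple functions does converge uniformly to [f]; hence the property defining
   [ba_integral] is not vacuous and pins its value to [l]. *)
have /boolp.choice[gs gsP] (n : nat) : exists g1, close g1 n.+1%:R^-1.
  by apply: approx; rewrite invr_gt0.
have gsf : {uniform, (fun n => gs n : Omega -> R) @ \oo --> f}.
  apply/cvg_uniform_distP => e1 e10; near=> n => x.
  apply: (le_trans ((gsP n).2 x)).
  by apply: ltW; near: n; exact: near_infty_natSinv_lt (PosNum e10).
have -> : ba_integral nu f = l.
  rewrite /ba_integral; set S := [set _ | _].
  have : S (get S) by apply: getPex; exists l.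
  move=> /(_ gs gsf) => H.
  by apply: EFin_inj; apply: (cvg_unique _ H (cvgl gs gsf)).
by move=> e0 fg; apply: lP.
Unshelve. all: by end_near.
Qed.

Lemma ba_integral_sfun nu g : ba_integral nu g = sfun_integral (ba_real nu) g.
Proof.
have [M nuM] := ba_variation nu.
apply/eqP; rewrite -subr_eq0 -normr_le0 -(mul0r M).
apply: ba_integral_approx => //; first exact: simple_bounded.
by move=> x; rewrite subrr normr0.
Qed.

End ba_integral_theory.

(** * Bounded charges from nonnegative contents *)

Section ba_of_content.
Context (d : measure_display) (Omega : measurableType d) (R : realType).
Variables (m : set Omega -> R) (madd : finitely_additive m).
Hypothesis m0 : forall A, measurable A -> 0 <= m A.

Let nu : set Omega -> \bar R := EFin \o m.

Let nu_fin : fin_num_fun nu. Proof. by []. Qed.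

Let nu_add : measure_function.semi_additive nu.
Proof.
by move=> A n mA tA _; rewrite /nu/= finitely_additive_bigsetU// sumEFin.
Qed.

HB.instance Definition _ := isFinite.Build _ _ _ nu nu_fin.
HB.instance Definition _ := isAdditiveCharge.Build _ _ _ nu nu_add.

Let nu_bounded : bounded_total_variation nu.
Proof.
exists (m setT) => n A mA tA; rewrite sumEFin lee_fin.
rewrite -[leLHS]/(\sum_(i < n) `|m (A i)|).
exact: (variation_at_most_mass madd m0).

Qed.

Definition ba_of_content : ba Omega R := Ba nu_bounded.

Lemma ba_of_contentE A : ba_of_content A = (m A)%:E. Proof. by []. Qed.

End ba_of_content.

(** * Finite measures as real-valued contents *)

Section finite_measure_content.
Context (d : measure_display) (Omega : measurableType d) (R : realType).
Variable mu : {finite_measure set Omega -> \bar R}.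

Lemma measure_content_add : finitely_additive (fine \o mu).
Proof.
apply: finitely_additive_fine; last exact: measure_semi_additive.
by move=> A mA; exact: fin_num_measure.
Qed.

Lemma measure_content_ge0 A : measurable A -> 0 <= (fine \o mu) A.
Proof. by move=> _; rewrite /= fine_ge0. Qed.

Lemma measure_sintegral (g : {sfun Omega >-> R}) :
  sintegral mu g = (sfun_integral (fine \o mu) g)%:E.
Proof.
by apply: sintegral_fine => // A mA; exact: fin_num_measure.
Qed.

Section integral_sfun.
Import HBNNSimple.
Variables (g : {sfun Omega >-> R}) (g0 : forall x, 0 <= g x).

HB.instance Definition _ := isNonNegFun.Build _ _ g g0.

Lemma integral_sfun :
  (\int[mu]_x (g x)%:E)%E = (sfun_integral (fine \o mu) g)%:E.
Proof. by rewrite -measure_sintegral -integralT_nnsfun. Qed.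

End integral_sfun.

End finite_measure_content.

(** * The weak-* closed convex hull *)

(* Otherwise moving a near-minimizer [y] of the distance to [x] towards a
   point of [E] beyond the orthogonal hyperplane would shorten the distance. *)
Lemma convex_approx (R : realType) (n : nat) (C E : set ('I_n -> R))
    (x : 'I_n -> R) (D : R) : C !=set0 ->
  (forall t y z, 0 <= t <= 1 -> C y -> E z ->
    C (fun i => (1 - t) * y i + t * z i)) ->
  (forall y z, C y -> E z -> \sum_(i < n) (z i - y i) ^+ 2 <= D) ->
  (forall (a : 'I_n -> R) e, 0 < e -> exists2 z, E z &
    \sum_(i < n) a i * (x i - z i) < e) ->
  forall e, 0 < e -> exists2 y, C y & forall i, `|y i - x i| < e.
Proof.
move=> [y0 Cy0] Cmix CED Esup e e0.
pose Q (y : 'I_n -> R) := \sum_(i < n) (y i - x i) ^+ 2.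
have Q0 y : 0 <= Q y by apply: sumr_ge0 => i _; exact: sqr_ge0.
suff [y Cy Qy] : exists2 y, C y & Q y < e ^+ 2.
  exists y => // i; rewrite -(@ltr_pXn2r _ 2)// ?nnegrE ?(ltW e0)//.
  rewrite real_normK ?num_real//; apply: le_lt_trans Qy.
  rewrite /Q (bigD1 i)//= lerDl; apply: sumr_ge0 => j _; exact: sqr_ge0.
pose de := inf [set Q y | y in C].
have lb : lbound [set Q y | y in C] 0 by move=> _ [y _ <-].
have ne : [set Q y | y in C] !=set0 by exists (Q y0), y0.
have deQ y : C y -> de <= Q y.
  by move=> Cy; apply: ge_inf; [exists 0|exists y].
have de0 : 0 <= de by apply: lb_le_inf.
have hasi : has_inf [set Q y | y in C] by split=> //; exists 0.
have [dp|dn] := ltP 0 de; last first.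
  have [|_ [y Cy <-] Qy] := inf_adherent (eps := e ^+ 2) _ hasi; first exact: exprn_gt0.
  by exists y => //; move: Qy; rewrite -/de; lra.
exfalso.
have D0 : 0 <= D.
  have [z Ez _] := Esup (fun=> 0) 1 ltr01.
  by apply: le_trans (CED _ _ Cy0 Ez); apply: sumr_ge0 => i _; exact: sqr_ge0.
have D1 : 0 < D + 1 + de by lra.
(* This [t] satisfies [t <= 1] and [t * D <= de / 2]. The excess of [Q y] over [de] and the
   quadratic term are each at most [t * de / 2], while the linear term is below [- (t * de)]; so the
   new point would have [Q] below [de]. *)
pose t := de / (2 * (D + 1 + de)).
have t0 : 0 < t by rewrite divr_gt0// mulr_gt0.
have tE : t * (2 * (D + 1 + de)) = de by rewrite /t divfK// gt_eqF// mulr_gt0.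
have t1 : t <= 1 by nra.
have [|_ [y Cy <-] Qy] := inf_adherent (eps := t * de / 2) _ hasi.
  by rewrite divr_gt0// mulr_gt0.
rewrite -/de in Qy.
have d2 : 0 < de / 2 by rewrite divr_gt0.
have [z Ez zP] := Esup (fun i => x i - y i) _ d2.
have tI : 0 <= t <= 1 by rewrite (ltW t0).
have := deQ _ (Cmix t y z tI Cy Ez).
have QE : Q (fun i => (1 - t) * y i + t * z i) = Q y +
    2 * t * (\sum_(i < n) (x i - y i) * (x i - z i) - Q y) +
    t ^+ 2 * \sum_(i < n) (z i - y i) ^+ 2.
  rewrite /Q -sumrB !mulr_sumr -!big_split/=; apply: eq_bigr => i _; ring.
rewrite QE => H.
have := CED _ _ Cy Ez; have := deQ _ Cy.
set S2 := \sum_(i < n) (z i - y i) ^+ 2 in H *.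
set S1 := \sum_(i < n) _ in zP H *.
move=> H1 H2.
have T1 : t ^+ 2 * S2 <= t * (t * D) by rewrite expr2 -mulrA !ler_pM2l.
have T2 : t * D <= de / 2 by nra.
have T3 : t * (t * D) <= t * (de / 2) by rewrite ler_pM2l.
have T4 : t * (S1 - Q y) < t * (de / 2 - de) by rewrite ltr_pM2l//; lra.
lra.
Qed.

Section convex_hull_theory.
Context (d : measure_display) (Omega : measurableType d) (R : realType).
Variables (P : set (probability Omega R)).
Implicit Types (g : {sfun Omega >-> R}) (mu nu : ba Omega R) (p : probability Omega R).

Let I p g := sfun_integral (fine \o p) g.

Lemma convex_hull_content mu : convex_hull P mu ->
  exists n (w : 'I_n -> R) (p : 'I_n -> probability Omega R),
  [/\ forall i, 0 <= w i, \sum_(i < n) w i = 1, forall i, P (p i)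
    & forall A, measurable A -> ba_real mu A = \sum_(i < n) w i * fine (p i A)].
Proof.
move=> [n [w [p [w0 w1 Pp muE]]]]; exists n, w, p; split=> // A mA.
rewrite /ba_real/= muE//.
rewrite (eq_bigr (fun i => (w i * fine (p i A))%:E)) ?sumEFin// => i _.
by rewrite EFinM fineK// fin_num_measure.
Qed.

Lemma convex_hull_ge0 mu A : convex_hull P mu -> measurable A ->
  0 <= ba_real mu A.
Proof.
move=> /convex_hull_content[n [w [p [w0 w1 Pp muE]]]] mA.
by rewrite muE//; apply: sumr_ge0 => i _; rewrite mulr_ge0// fine_ge0.
Qed.

Lemma convex_hull_variation mu : convex_hull P mu ->
  variation_at_most (ba_real mu) 1.
Proof.
move=> Cmu; rewrite (_ : 1 = ba_real mu setT).
  by apply: variation_at_most_mass => [|A]; [exact: ba_add|exact: convex_hull_ge0].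
have [n [w [p [w0 w1 Pp ->//]]]] := convex_hull_content Cmu.
by rewrite -w1; apply: eq_bigr => i _; rewrite probability_setT/= mulr1.
Qed.

Lemma convex_hull_sfun_integral mu : convex_hull P mu ->
  exists n (w : 'I_n -> R) (p : 'I_n -> probability Omega R),
  [/\ forall i, 0 <= w i, \sum_(i < n) w i = 1, forall i, P (p i)
    & forall g, sfun_integral (ba_real mu) g = \sum_(i < n) w i * I (p i) g].
Proof.
move=> /convex_hull_content[n [w [p [w0 w1 Pp muE]]]].
exists n, w, p; split=> // g.
by rewrite (eq_sfun_integral g muE) sfun_integral_lincomb.
Qed.

(** Moving towards a single element of [P] is the step that [convex_approx] makes. *)
Lemma convex_hull_mix mu p t : convex_hull P mu -> P p -> 0 <= t <= 1 ->
  exists2 mu', convex_hull P mu' & forall g, sfun_integral (ba_real mu') g =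
    (1 - t) * sfun_integral (ba_real mu) g + t * I p g.
Proof.
move=> Cmu Pp /andP[t0 t1]; have t1' : 0 <= 1 - t by rewrite subr_ge0.
have [n [w [q [w0 w1 Pq muE]]]] := convex_hull_content Cmu.
pose m A := (1 - t) * ba_real mu A + t * fine (p A).
have madd : finitely_additive m.
  move=> A B mA mB AB; rewrite /m ba_add//.
  have := measure_content_add p mA mB AB; rewrite /= => ->; ring.
have m0 A : measurable A -> 0 <= m A.
  move=> mA; apply: addr_ge0; apply: mulr_ge0 => //; last exact: fine_ge0.
  exact: convex_hull_ge0.
exists (ba_of_content madd m0).
  exists n.+1, (fun i => if unlift ord0 i is Some j then (1 - t) * w j else t),
    (fun i => if unlift ord0 i is Some j then q j else p); split.
  - by move=> i; case: unliftP => // j _; rewrite mulr_ge0.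
  - rewrite big_ord_recl unlift_none.
    under eq_bigr do rewrite liftK.
    by rewrite -mulr_sumr w1 mulr1 addrC subrK.
  - by move=> i; case: unliftP.
  - move=> A mA; rewrite big_ord_recl unlift_none.
    under eq_bigr do rewrite liftK.
    rewrite ba_of_contentE /m muE// addrC EFinD EFinM fineK ?fin_num_measure//.
    rewrite mulr_sumr -sumEFin; congr (_ + _)%E; apply: eq_bigr => i _.
    by rewrite mulrA EFinM fineK// fin_num_measure.
move=> g; rewrite /I /sfun_integral !mulr_sumr -big_split/=.
by apply: eq_bigr => x _; rewrite {1}/ba_real/= /m; ring.
Qed.

(** Since [nu] and the elements of the hull all have variation at most 1, replacing a bounded
    function by a uniformly close simple one changes their integrals by a uniformly small amount.
    Closeness on finite families of simple functions is therefore enough. *)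
Lemma closed_convex_hull_closure nu : variation_at_most (ba_real nu) 1 ->
  (forall n (g : 'I_n -> {sfun Omega >-> R}) e, 0 < e ->
    exists2 mu, convex_hull P mu & forall i,
      `|sfun_integral (ba_real mu) (g i) - sfun_integral (ba_real nu) (g i)| < e) ->
  closed_convex_hull P nu.
Proof.
move=> nu1 approx B nuB.
(* These sets generate a proper filter of subsets of the hull. Its convergence to [nu] in the
   supremum topology is checked one function at a time through [cvg_sup]. *)
pose near (se : seq {classic bounded_mfun Omega R} * R) := [set mu | convex_hull P mu /\
  forall f : {classic bounded_mfun Omega R}, f \in se.1 ->
    `|ba_integral nu (sval f) - ba_integral mu (sval f)| < se.2].
pose D := [set se : seq {classic bounded_mfun Omega R} * R | 0 < se.2].
have near0 se : D se -> near se !=set0.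
  (* One third each for replacing [f] by [G f] under [nu] and under [mu], and one for the gap
     between [nu] and [mu] on [G f]. *)
  case: se => s e /= e0; have e30 : 0 < e / 3 by rewrite divr_gt0.
  have /boolp.choice[G GP] (f : {classic bounded_mfun Omega R}) :
      exists g : {sfun Omega >-> R}, forall x, `|sval f x - g x| <= e / 3.
    exact: bounded_sfun_approx (svalP f) e30.
  have [mu Cmu muP] := approx (size s) (fun i => G (tnth (in_tuple s) i)) _ e30.
  exists mu; split=> // f /= fs.
  have is_ : (index f s < size s)%N by rewrite index_mem.
  have := muP (Ordinal is_); rewrite (tnth_nth f)/= nth_index// => H.
  have mf : measurable_fun setT (sval f) by [].
  have H1 := ba_integral_approx nu1 mf (svalP f) (ltW e30) (GP f).
  have H2 := ba_integral_approx (convex_hull_variation Cmu) mf (svalP f) (ltW e30) (GP f).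
  move: H1 H2 H; rewrite mulr1 !ler_norml !ltr_norml; lra.
pose F : set_system (ba Omega R) := filter_from D near.
have FF : ProperFilter F.
  apply: filter_from_proper => //; apply: filter_from_filter.
    by exists ([::], 1); rewrite /D /=.
  move=> [s e] [s' e']; rewrite /D/= => e0 e'0.
  exists (s ++ s', Num.min e e'); first by rewrite /= lt_min e0.
  move=> mu [Cmu muP]; split; split=> // f /= fs.
    have := muP f; rewrite /= mem_cat fs => /(_ isT).
    by rewrite lt_min => /andP[].
  have := muP f; rewrite /= mem_cat fs orbT => /(_ isT).
  by rewrite lt_min => /andP[].
have Fnu : F --> nu.
  apply/cvg_sup => f A; rewrite nbhsE => -[U [[V oV <-] Vnu] UA].
  have : nbhs (ba_integral nu (sval f)) V by exact: open_nbhs_nbhs.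
  move=> /nbhs_ballP[e /= e0 eV].
  exists ([:: f], e) => // mu [_ muP]; apply: UA; apply: eV.
  by apply: muP; rewrite inE.
have [se Dse seB] := Fnu _ nuB.
by have [mu muse] := near0 _ Dse; exists mu; split; [exact: muse.1|exact: seB].
Qed.

(** The set where the integral of [g] exceeds [c] is weak-* open. If it contained [nu], it would
    contain a convex combination of [P], whose integral of [g] is a weighted mean of numbers at most
    [c]. *)
Lemma closed_convex_hull_sfun_le nu g c : closed_convex_hull P nu ->
  (forall p, P p -> I p g <= c) -> sfun_integral (ba_real nu) g <= c.
Proof.
move=> Cnu Pc; rewrite leNgt; apply/negP => cnu.
pose f : bounded_mfun Omega R := exist _ (g : {mfun Omega >-> R}) (simple_bounded g).
have : nbhs nu [set mu | c < ba_integral mu g].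
  have : nbhs nu --> nu by [].
  move=> /cvg_sup /(_ f); apply.
  exists ((fun mu : ba Omega R => ba_integral mu (sval f)) @^-1` [set r | c < r]);
    split => //=.
    by eexists; last reflexivity; exact: open_gt.
  by rewrite ba_integral_sfun.
move=> /Cnu[mu [Cmu /=]]; rewrite ba_integral_sfun.
have [n [w [q [w0 w1 Pq ->]]]] := convex_hull_sfun_integral Cmu.
apply/negP; rewrite -leNgt -[leRHS]mul1r -w1 mulr_suml.
by apply: ler_sum => i _; apply: ler_wpM2l => //; exact/Pc.
Qed.

End convex_hull_theory.

(** * Duality between the effective null and the closed convex hull *)

Section domination.
Context (d : measure_display) (Omega : measurableType d) (R : realType).
Variables (P : set (probability Omega R)) (P0 : P !=set0).
Implicit Types (g h : {sfun Omega >-> R}) (p : probability Omega R).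

Let I p g := sfun_integral (fine \o p) g.

Lemma probability_sfun_le p g c : (forall x, g x <= c) -> I p g <= c.
Proof.
move=> gc; apply: (@le_trans _ _ (I p (cst_sfun c))).
  apply: le_sfun_integral => //; [exact: measure_content_add|].
  exact: measure_content_ge0.
rewrite /I sfun_integral_cst; last exact: measure_content_add.
by rewrite /= probability_setT/= mulr1.
Qed.

Lemma probability_variation p : variation_at_most (fine \o p) 1.
Proof.
rewrite (_ : 1 = (fine \o p) setT); last by rewrite /= probability_setT.
apply: variation_at_most_mass; first exact: measure_content_add.
exact: measure_content_ge0.
Qed.

Lemma sfun_ubound g : exists c, forall x, g x <= c.
Proof.
have [M0 [_ HM]] := simple_bounded g; exists (`|M0| + 1) => x.
rewrite (le_trans (ler_norm _))//; apply: HM => //.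
by rewrite (le_lt_trans (ler_norm _))// ltrDl.
Qed.

(** The support functional of [P] on simple functions. The supremum is genuine because simple
    functions are bounded and [P] is nonempty. *)
Definition upper_integral g : R := sup [set I p g | p in P].

Lemma upper_integral_ub p g : P p -> I p g <= upper_integral g.
Proof.
move=> Pp; apply: ub_le_sup; last by exists p.
have [c gc] := sfun_ubound g; exists c => _ [q Pq <-].
exact: probability_sfun_le.
Qed.

Lemma upper_integral_le g c : (forall p, P p -> I p g <= c) ->
  upper_integral g <= c.
Proof.
move=> Ic; apply: ge_sup; last by move=> _ [p Pp <-]; exact: Ic.
by have [p Pp] := P0; exists (I p g), p.
Qed.

Lemma upper_integral_sublinear : sublinear upper_integral.
Proof.
split=> [g h|t g].
  apply: upper_integral_le => p Pp.
  rewrite /I sfun_integralD; last exact: measure_content_add.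
  by apply: lerD; exact: upper_integral_ub.
rewrite le_eqVlt => /predU1P[<-|t0].
  rewrite mul0r; apply/le_anti/andP; split.
    apply: upper_integral_le => p Pp.
    by rewrite /I sfun_integralZ ?mul0r//; exact: measure_content_add.
  have [p Pp] := P0; apply: le_trans (upper_integral_ub _ Pp).
  by rewrite /I sfun_integralZ ?mul0r//; exact: measure_content_add.
apply/le_anti/andP; split.
  apply: upper_integral_le => p Pp.
  rewrite /I sfun_integralZ; last exact: measure_content_add.
  by rewrite ler_pM2l//; exact: upper_integral_ub.
rewrite -ler_pdivlMl//; apply: upper_integral_le => p Pp.
rewrite ler_pdivlMl//; apply: le_trans (upper_integral_ub _ Pp).
by rewrite /I sfun_integralZ//; exact: measure_content_add.
Qed.

Lemma effective_null_upper (mu : {finite_measure set Omega -> \bar R}) g :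
  effective_null P mu -> (forall x, 0 <= g x) ->
  sfun_integral (fine \o mu) g <= upper_integral g.
Proof.
move=> Pmu g0.
have s0 : 0 <= upper_integral g.
  have [p Pp] := P0; apply: le_trans (upper_integral_ub _ Pp).
  apply: sfun_integral_ge0 => //; exact: measure_content_ge0.
(* The slack [e] makes [c] positive even when the upper integral is 0, so that dividing [g] by [c]
   yields an e-variable. *)
apply/ler_addgt0Pr => e e0; set c := _ + e.
have c0 : 0 < c by rewrite ltr_wpDl.
have h0 x : 0 <= (c^-1 *: g) x by rewrite sfunZ mulr_ge0// invr_ge0 ltW.
have : e_variable P (fun x => ((c^-1 *: g) x)%:E).
  split=> [|x|p Pp]; last 1 first.
  - rewrite integral_sfun// lee_fin sfun_integralZ; last exact: measure_content_add.
    rewrite ler_pdivrMl// mulr1; apply: le_trans (upper_integral_ub g Pp) _.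
    by rewrite lerDl ltW.
  - exact/measurable_EFinP.
  - by rewrite lee_fin.
move=> /Pmu; rewrite integral_sfun// lee_fin sfun_integralZ; last exact: measure_content_add.
by rewrite ler_pdivrMl// mulr1.
Qed.

(** * Positive linear functionals below the upper integral *)

Section representation.
Variable L : {sfun Omega >-> R} -> R.
Hypothesis LD : forall g h, L (g + h) = L g + L h.
Hypothesis LZ : forall t g, L (t *: g) = t * L g.
Hypothesis Ls : forall g, L g <= upper_integral g.
Hypothesis L0 : forall g, (forall x, 0 <= g x) -> 0 <= L g.

(** [indic_sfun] takes a proof of measurability, hence the case analysis; the value 0 on other sets
    is a default. *)
Let m (A : set Omega) : R :=
  if pselect (measurable A) is left mA then L (indic_sfun A mA) else 0.

Let mE A (mA : measurable A) : m A = L (indic_sfun A mA).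
Proof.
rewrite /m; case: pselect => // mA'; congr L.
by apply/sfuneqP => x; rewrite !indic_sfunE.
Qed.

Let madd : finitely_additive m.
Proof.
move=> A B mA mB AB; rewrite (mE (measurableU _ _ mA mB)) (mE mA) (mE mB) -LD.
congr L; apply/sfuneqP => x; rewrite sfunD/= !indic_sfunE in_setU.
have : ~ (x \in A /\ x \in B).
  by move=> [/set_mem Ax /set_mem Bx]; suff : (A `&` B) x by rewrite AB.
case: (x \in A); case: (x \in B) => //=; rewrite ?addr0 ?add0r//.
by move=> /(_ (conj isT isT)).
Qed.

Let m0 A : measurable A -> 0 <= m A.
Proof.
move=> mA; rewrite (mE mA); apply: L0 => x.
by rewrite indic_sfunE ler0n.
Qed.

Let nu := ba_of_content madd m0.

Let nuE g : sfun_integral (ba_real nu) g = L g.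
Proof.
have Lsum (s : seq R) (F : R -> {sfun Omega >-> R}) :
    L (\sum_(x <- s) F x) = \sum_(x <- s) L (F x).
  elim: s => [|x s IH]; last by rewrite !big_cons LD IH.
  by rewrite !big_nil -(scale0r 0) LZ mul0r.
rewrite /sfun_integral; set r := finmap.enum_fset _.
(* [g] is the sum of its values times the indicators of its fibers; at [w] only the term of the
   value [g w] survives. *)
have -> : L g = L (\sum_(x <- r) x *: indic_sfun _ (measurable_sfun_fiber g x)).
  congr L; apply/sfuneqP => w; rewrite sfun_sum.
  have wr : g w \in r.
    by rewrite in_fset_set ?inE; [exists w|exact: fimfunP].
  rewrite (big_rem (g w))// big1_seq.
    by rewrite sfunZ indic_sfun1// mulr1 /= addr0.
  move=> x /andP[_]; rewrite mem_rem_uniq ?finmap.fset_uniq// inE => /andP[xg _].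
  rewrite sfunZ indic_sfun0 ?mulr0// => gx.
  by move: xg; rewrite -gx/= eqxx.
rewrite Lsum; apply: eq_bigr => x _; rewrite LZ; congr (_ * _).
by rewrite -(mE (measurable_sfun_fiber g x)).
Qed.

(** [L] is integration against the content [m], whose mass is at most 1. For a finite family [g],
    [convex_approx] is applied to the vectors of integrals, with [C] coming from the convex hull and
    [E] from [P]. *)
Lemma closed_convex_hull_representation : exists2 nu : ba Omega R, closed_convex_hull P nu &
  forall g, sfun_integral (ba_real nu) g = L g.
Proof.
exists nu => //; apply: closed_convex_hull_closure.
  move=> n A mA tA; apply: (@le_trans _ _ (m setT)).
    exact: (variation_at_most_mass madd m0).
  rewrite (mE measurableT); apply: le_trans (Ls _) _.
  apply: upper_integral_le => p Pp; apply: probability_sfun_le => x.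
  by rewrite indic_sfunE mem_set.
move=> n g e e0; have [p0 Pp0] := P0.
pose C := [set y : 'I_n -> R | exists2 mu : ba Omega R, convex_hull P mu &
  forall i, y i = sfun_integral (ba_real mu) (g i)].
pose E := [set z : 'I_n -> R | exists2 p, P p & forall i, z i = I p (g i)].
have [mu0 Cmu0] : convex_hull P !=set0.
  exists (ba_of_content (measure_content_add p0) (measure_content_ge0 p0)).
  exists 1%N, (fun=> 1), (fun=> p0); split=> //; first by rewrite big_ord1.
  move=> A mA; rewrite big_ord1 mul1e ba_of_contentE/= fineK//.
  exact: fin_num_measure.
have [c c0 gc] : exists2 c : R, 0 <= c & forall i x, `|g i x| <= c.
  have /boolp.choice[b gb] (i : 'I_n) : exists b, forall x, `|g i x| <= b.
    have [b1 gb1] := sfun_ubound (g i); have [b2 gb2] := sfun_ubound (- g i).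
    exists (Num.max b1 b2) => x; rewrite ler_norml lerNl !le_max gb1 andbT.
    by apply/orP; right; exact: gb2.
  exists (\sum_(i < n) `|b i|) => [|i x]; first by apply: sumr_ge0.
  rewrite (le_trans (gb i x))// (le_trans (ler_norm _))// (bigD1 i)//= lerDl.
  exact: sumr_ge0.
(* All coordinates of points of [C] and [E] are at most [c] in absolute value, whence this bound on
   squared distances. *)
have [||| |y [mu Cmu muy] yx] := @convex_approx R n C E (fun i => L (g i))
  (n%:R * (c + c) ^+ 2) _ _ _ _ e e0.
- by exists (fun i => sfun_integral (ba_real mu0) (g i)), mu0.
- move=> t y z t01 [mu Cmu yE] [p Pp zE].
  have [mu' Cmu' mu'E] := convex_hull_mix Cmu Pp t01.
  by exists mu' => // i; rewrite mu'E yE zE.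
- move=> y z [mu Cmu yE] [p Pp zE].
  rewrite -[n in n%:R]card_ord mulr_natl -sumr_const; apply: ler_sum => i _.
  rewrite -real_normK ?num_real// lerXn2r ?nnegrE ?addr_ge0//.
  rewrite (le_trans (ler_normB _ _))// lerD//.
    rewrite zE -[c]mulr1; apply: sfun_integral_bound => //.
      exact: measure_content_add.
    exact: probability_variation.
  rewrite yE -[c]mulr1; apply: sfun_integral_bound => //; first exact: ba_add.
  exact: (convex_hull_variation Cmu).
- move=> a e1 e10; pose h := \sum_(i < n) a i *: g i.
  have Isum (J : {sfun Omega >-> R} -> R) :
      (forall g h, J (g + h) = J g + J h) -> (forall t g, J (t *: g) = t * J g) ->
      J h = \sum_(i < n) a i * J (g i).
    move=> JD JZ; have J0 : J 0 = 0 by rewrite -(scale0r 0) JZ mul0r.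
    by rewrite /h (big_morph J JD J0); apply: eq_bigr => i _; rewrite JZ.
  (* Some [p] in [P] comes within [e1] of [upper_integral h], which is at least [L h]; this is the
     hyperplane condition for the coefficients [a]. *)
  have [_ [p Pp <-]] : exists2 r, [set I p h | p in P] r & upper_integral h - e1 < r.
    apply: sup_adherent => //; split; first by exists (I p0 h), p0.
    have [b hb] := sfun_ubound h; exists b => _ [q Pq <-].
    exact: probability_sfun_le.
  move=> He; exists (fun i => I p (g i)); first by exists p.
  under eq_bigr do rewrite mulrBr.
  rewrite sumrB -(Isum L LD LZ) -(Isum (I p)).
  + by have := Ls h; lra.
  + by move=> g1 h1; apply: sfun_integralD; exact: measure_content_add.
  + by move=> t g1; apply: sfun_integralZ; exact: measure_content_add.
by exists mu => // i; rewrite nuE -muy.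
Qed.

End representation.

Lemma effective_null_dominated (mu : {finite_measure set Omega -> \bar R}) :
  effective_null P mu ->
  exists2 nu : ba Omega R, closed_convex_hull P nu & setwise_le mu nu.
Proof.
move=> Pmu.
pose J := sfun_integral (fine \o mu).
have JD : forall g h, J (g + h) = J g + J h.
  by move=> g h; apply: sfun_integralD; exact: measure_content_add.
have JZ : forall t g, J (t *: g) = t * J g.
  by move=> t g; apply: sfun_integralZ; exact: measure_content_add.
(* With this cone, a linear functional below [infconv upper_integral K] is below the upper integral
   and dominates [J] on nonnegative simple functions. *)
pose K := [set u : {sfun Omega >-> R} * R | (forall x, 0 <= u.1 x) /\ u.2 = J u.1].
have K0 : K (0, 0).
  split=> [x|] /=; first exact: lexx.
  by rewrite -(scale0r (0 : {sfun Omega >-> R})) JZ mul0r.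
have KD u v : K u -> K v -> K (u.1 + v.1, u.2 + v.2).
  move=> [u0 uJ] [v0 vJ]; split=> [x|]/=; last by rewrite JD uJ vJ.
  by rewrite addr_ge0.
have KZ t u : 0 <= t -> K u -> K (t *: u.1, t * u.2).
  move=> t0 [u0 uJ]; split=> [x|]/=; last by rewrite JZ uJ.
  by rewrite mulr_ge0.
have Kle u : K u -> u.2 <= upper_integral u.1.
  by move=> [u0 ->]; exact: effective_null_upper.
have ss := upper_integral_sublinear.
have [L [LD LZ LI]] := hahn_banach (infconv_sublinear ss K0 KD KZ Kle).
have Ls g : L g <= upper_integral g.
  by apply: le_trans (LI g) _; exact: infconv_lep.
have LJ g : (forall x, 0 <= g x) -> J g <= L g.
  move=> g0; have Kg : K (g, J g) by [].
  have := le_trans (LI (- g)) (infconv_le ss Kle (- g) Kg).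
  rewrite /= addNr (sublinear0 ss) -scaleN1r LZ; lra.
have L0 g : (forall x, 0 <= g x) -> 0 <= L g.
  move=> g0; apply: le_trans (LJ g g0).
  by apply: sfun_integral_ge0 => //; exact: measure_content_ge0.
have [nu Cnu nuL] := closed_convex_hull_representation LD LZ Ls L0.
exists nu => // A mA.
rewrite -[leLHS]fineK ?fin_num_measure// -[leRHS]fineK ?ba_fin// lee_fin.
have := LJ (indic_sfun A mA); rewrite -nuL /J.
rewrite !sfun_integral_indic; [|exact: ba_add|exact: measure_content_add].
by apply => x; exact: indic_sfun_ge0.
Qed.

Import HBNNSimple.

(** As [nu] is only finitely additive, it is compared with [mu] and [P] on simple [h <= Z] alone;
    the integral of [Z] under [mu] is the supremum over these. *)
Lemma dominated_effective_null (mu : {finite_measure set Omega -> \bar R})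
    (nu : ba Omega R) :
  closed_convex_hull P nu -> setwise_le mu nu -> effective_null P mu.
Proof.
move=> Cnu munu Z [mZ Z0 PZ].
rewrite ge0_integralTE//; apply: ge_ereal_sup => _ [h /= hZ <-].
have h0 x : 0 <= h x by [].
pose h' : {sfun Omega >-> R} := h.
rewrite (measure_sintegral mu h') lee_fin.
apply: (@le_trans _ _ (sfun_integral (ba_real nu) h')).
  apply: le_sfun_integral_content => // A mA.
  by rewrite /= fine_le ?fin_num_measure ?ba_fin// munu.
apply: closed_convex_hull_sfun_le Cnu _ => p Pp.
rewrite -lee_fin -integral_sfun//; apply: le_trans (PZ p Pp).
apply: ge0_le_integral => //; first by move=> x _; rewrite lee_fin h0.
  by apply/measurable_EFinP; exact: measurable_funPT.
by move=> x _; exact: hZ.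
Qed.

End domination.

(** * Maximal elements of the effective null *)

Section chain_sup.
Context (d : measure_display) (Omega : measurableType d) (R : realType).
Variables (C : set {finite_measure set Omega -> \bar R}) (K : R).
Hypothesis C0 : C !=set0.
Hypothesis Ctot : forall m1 m2, C m1 -> C m2 ->
  setwise_le m1 m2 \/ setwise_le m2 m1.
Hypothesis CK : forall m, C m -> (m setT <= K%:E)%E.

Definition chain_content (A : set Omega) : R := sup [set fine (m A) | m in C].

Let fin (m : {finite_measure set Omega -> \bar R}) A :
  measurable A -> m A = (fine (m A))%:E.
Proof. by move=> mA; rewrite fineK// fin_num_measure. Qed.

Lemma chain_content_ub m A : C m -> measurable A -> fine (m A) <= chain_content A.
Proof.
move=> Cm mA; apply: ub_le_sup; last by exists m.
exists K => _ [m' Cm' <-]; rewrite -lee_fin -fin//.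
by apply: le_trans (CK Cm'); apply: le_measure; rewrite ?inE.
Qed.

Lemma chain_content_le A c : (forall m, C m -> fine (m A) <= c) ->
  chain_content A <= c.
Proof.
move=> Cc; apply: ge_sup; last by move=> _ [m Cm <-]; exact: Cc.
by have [m Cm] := C0; exists (fine (m A)), m.
Qed.

Lemma chain_content_ge0 A : 0 <= chain_content A.
Proof.
have [m Cm] := C0.
(* On a nonmeasurable set the values may be unbounded, and [sup] is then 0 by default. *)
have [ub|nub] := pselect (has_ubound [set fine (m A) | m in C]).
  apply: (@le_trans _ _ (fine (m A))); first by rewrite fine_ge0.
  by apply: ub_le_sup => //; exists m.
by rewrite /chain_content sup_out// => -[].
Qed.

(** For superadditivity, [m1] near the supremum at [A] and [m2] near it at [B] are comparable, and
    the larger one serves on both sets. *)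
Lemma chain_content_add : finitely_additive chain_content.
Proof.
move=> A B mA mB AB; have mAB := measurableU _ _ mA mB.
have add (m : {finite_measure set Omega -> \bar R}) :
    fine (m (A `|` B)) = fine (m A) + fine (m B).
  exact: measure_content_add.
apply/le_anti/andP; split.
  by apply: chain_content_le => m Cm; rewrite add lerD// chain_content_ub.
rewrite -lerBrDr; apply: chain_content_le => m1 Cm1.
rewrite lerBrDr -lerBrDl; apply: chain_content_le => m2 Cm2; rewrite lerBrDl.
have [m12|m21] := Ctot Cm1 Cm2.
  apply: le_trans (chain_content_ub Cm2 mAB); rewrite add lerD2r.
  by rewrite -lee_fin -!fin// m12.
apply: le_trans (chain_content_ub Cm1 mAB); rewrite add lerD2l.
by rewrite -lee_fin -!fin// m21.
Qed.

Let nu A := (chain_content A)%:E.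

Let nu0 : nu set0 = 0%E.
Proof. by rewrite /nu finitely_additive0//; exact: chain_content_add. Qed.

Let nu_ge0 A : (0 <= nu A)%E.
Proof. by rewrite lee_fin chain_content_ge0. Qed.

(** Partial sums are bounded by finite additivity and monotonicity of the members of the chain.
    Conversely, each member is countably additive and bounded by [nu] term by term. *)
Let nu_sigma_additive : semi_sigma_additive nu.
Proof.
move=> F mF tF mU.
have cvgF := @is_cvg_nneseries R (fun i => nu (F i)) xpredT 0%N (fun i _ _ => nu_ge0 _).
have partial n : (\sum_(0 <= i < n) nu (F i) <= nu (\bigcup_i F i))%E.
  rewrite big_mkord sumEFin -(finitely_additive_bigsetU n chain_content_add mF tF).
  have mn : measurable (\big[setU/set0]_(i < n) F i) by exact: bigsetU_measurable.
  rewrite lee_fin; apply: chain_content_le => m Cm.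
  apply: le_trans (chain_content_ub Cm mU).
  rewrite -lee_fin -!fin//; apply: le_measure; rewrite ?inE//.
  exact: bigsetU_bigcup.
have le1 : (\sum_(0 <= i <oo) nu (F i) <= nu (\bigcup_i F i))%E.
  by apply: lime_le => //; near=> n; exact: partial.
suff -> : nu (\bigcup_i F i) = (\sum_(0 <= i <oo) nu (F i))%E by [].
apply/le_anti; rewrite le1 andbT.
have Sge0 : (0 <= \sum_(0 <= i <oo) nu (F i))%E by exact: nneseries_ge0.
have Sfin : (\sum_(0 <= i <oo) nu (F i))%E \is a fin_num.
  by rewrite ge0_fin_numE// (le_lt_trans le1)// ltry.
rewrite -(fineK Sfin) lee_fin; apply: chain_content_le => m Cm.
rewrite -lee_fin (fineK Sfin) -fin//.
have /cvg_lim <- // := @measure_semi_sigma_additive _ _ _ m F mF tF mU.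
apply: lee_nneseries => [i _ _|i _]; first exact: measure_ge0.
by have := chain_content_ub Cm (mF i); rewrite -lee_fin -fin.
Unshelve. all: by end_near.
Qed.

HB.instance Definition _ := isMeasure.Build _ _ _ nu nu0 nu_ge0 nu_sigma_additive.

Let nu_fin : fin_num_fun nu. Proof. by []. Qed.

HB.instance Definition _ := Measure_isFinite.Build _ _ _ nu nu_fin.

Lemma chain_sup_measure : exists m : {finite_measure set Omega -> \bar R},
  forall A, m A = (chain_content A)%:E.
Proof. by exists nu. Qed.

End chain_sup.

Section finite_measure_add.
Context (d : measure_display) (Omega : measurableType d) (R : realType).
Variables m1 m2 : {finite_measure set Omega -> \bar R}.

Let m12 (n : nat) : {measure set Omega -> \bar R} := if n is 0%N then m1 else m2.

Let m12E A : msum m12 2 A = (m1 A + m2 A)%E.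
Proof. by rewrite /msum/= 2!big_ord_recl/= big_ord0 adde0. Qed.

Let add_fin : fin_num_fun (msum m12 2).
Proof. by move=> A mA; rewrite m12E fin_numD !fin_num_measure. Qed.

HB.instance Definition _ := Measure_isFinite.Build _ _ _ (msum m12 2) add_fin.

Lemma finite_measure_add : exists m : {finite_measure set Omega -> \bar R},
  forall A, m A = (m1 A + m2 A)%E.
Proof. by exists (msum m12 2). Qed.

End finite_measure_add.

(** * Zorn's lemma in the effective null and the solid hull *)

Section effective_null_theory.
Context (d : measure_display) (Omega : measurableType d) (R : realType).
Variables (P : set (probability Omega R)).
Implicit Types (m : {finite_measure set Omega -> \bar R}).

(** The constant 1 is an e-variable. *)
Lemma effective_null_mass m : effective_null P m -> (m setT <= 1%:E)%E.
Proof.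
move=> /(_ (cst 1%E)); rewrite integral_cst// mul1e; apply; split => //.
by move=> p Pp; rewrite integral_cst// mul1e; exact: probability_le1.
Qed.

Import HBNNSimple.

(** If [m'] in the chain has nearly the mass of the supremum [m], then [m - m'] has small variation,
    so a simple [g <= Z] has nearly the same integral under both. *)
Lemma effective_null_chain (C : set {finite_measure set Omega -> \bar R}) :
  C !=set0 -> C `<=` effective_null P ->
  (forall m1 m2, C m1 -> C m2 -> setwise_le m1 m2 \/ setwise_le m2 m1) ->
  exists2 m, effective_null P m & forall m', C m' -> setwise_le m' m.
Proof.
move=> C0 CP Ctot.
have CK m : C m -> (m setT <= 1%:E)%E by move=> /CP; exact: effective_null_mass.
have [m mE] := chain_sup_measure C0 Ctot CK.
have ub m' A : C m' -> measurable A -> fine (m' A) <= fine (m A).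
  by move=> Cm' mA; rewrite mE/=; exact: chain_content_ub CK _ _ _ _.
exists m; last first.
  move=> m' Cm' A mA.
  by rewrite -[leLHS]fineK ?fin_num_measure// -[leRHS]fineK ?fin_num_measure// lee_fin ub.
move=> Z [mZ Z0 PZ].
rewrite ge0_integralTE//; apply: ge_ereal_sup => _ [h /= hZ <-].
have h0 x : 0 <= h x by [].
pose g : {sfun Omega >-> R} := h.
rewrite (measure_sintegral m g) lee_fin.
have [c gc] := sfun_ubound g.
have c0 : 0 <= `|c| by [].
apply/ler_addgt0Pr => e e0.
(* [|c|] bounds [g], so a mass defect of [e / (|c| + 1)] costs at most [e] in the integral. *)
have e1 : 0 < e / (`|c| + 1) by rewrite divr_gt0// ltr_wpDl.
have [_ [m' Cm' <-] m'e] : exists2 r, [set fine (m' setT) | m' in C] r &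
    fine (m setT) - e / (`|c| + 1) < r.
  rewrite mE/=; apply: sup_adherent => //; split.
    by have [m' Cm'] := C0; exists (fine (m' setT)), m'.
  exists 1 => _ [m' Cm' <-]; rewrite -lee_fin fineK ?fin_num_measure//.
  exact: CK.
pose k A := fine (m A) - fine (m' A).
have kadd : finitely_additive k.
  move=> A B mA mB AB; rewrite /k.
  have /= -> := measure_content_add m mA mB AB.
  have /= -> := measure_content_add m' mA mB AB.
  ring.
have k0 A : measurable A -> 0 <= k A by move=> mA; rewrite subr_ge0 ub.
have H1 : sfun_integral (fine \o m') g <= 1.
  rewrite -lee_fin -integral_sfun//; apply: le_trans (CP _ Cm' Z _) => //.
  apply: ge0_le_integral => //; first by move=> x _; rewrite lee_fin h0.
    by apply/measurable_EFinP; exact: measurable_funPT.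
  by move=> x _; exact: hZ.
have H2 : sfun_integral k g <= e.
  apply: le_trans (ler_norm _) _.
  have kv := variation_at_most_mass kadd k0.
  apply: (le_trans (sfun_integral_bound (e := `|c|) kadd kv _ _)) => //.
    by move=> x; rewrite ger0_norm ?h0//; exact: le_trans (gc x) (ler_norm c).
  apply: (@le_trans _ _ (`|c| * (e / (`|c| + 1)))).
    by apply: ler_wpM2l => //; rewrite /k; lra.
  by rewrite mulrCA ger_pMr// ler_pdivrMr ?ltr_wpDl// mul1r lerDl.
have : sfun_integral (fine \o m) g = sfun_integral (fine \o m') g + sfun_integral k g.
  rewrite /sfun_integral -big_split/=; apply: eq_bigr => x _.
  by rewrite /k; ring.
by lra.
Qed.

(** Zorn's lemma is applied to the elements above [m]. Anything above one of them is again above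
    [m], so maximality there is maximality in the whole effective null. *)
Lemma effective_null_maximal m : effective_null P m ->
  exists2 m', maximal_effective_null P m' & setwise_le m m'.
Proof.
move=> Pm.
pose S := {m' : {finite_measure set Omega -> \bar R} |
  effective_null P m' /\ setwise_le m m'}.
pose D : rel S := fun u w => `[< setwise_le (sval u) (sval w) >].
have mm : setwise_le m m by move=> A _.
pose u0 : S := exist _ m (conj Pm mm).
have [u umax] : exists u, premaximal D u.
  apply: (ZL_preorder u0).
  - by move=> u; apply/asboolP => A _.
  - move=> u v w /asboolP vu /asboolP uw; apply/asboolP => A mA.
    exact: le_trans (vu A mA) (uw A mA).
  - move=> A Atot; have [A0|/set0P[v Av]] := eqVneq A set0.
      by exists u0 => w; rewrite A0.
    have [||_ _ [w1 Aw1 <-] [w2 Aw2 <-]|m' Pm' m'ub] :=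
      @effective_null_chain [set sval w | w in A].
    - by exists (sval v), v.
    - by move=> _ [w Aw <-]; exact: (svalP w).1.
    - by have [/asboolP|/asboolP] := Atot _ _ Aw1 Aw2; [left|right].
    have mm' : setwise_le m m'.
      move=> B mB; apply: le_trans ((svalP v).2 B mB) _.
      by apply: m'ub => //; exists v.
    exists (exist _ m' (conj Pm' mm')) => w Aw; apply/asboolP => /=.
    by apply: m'ub; exists w.
exists (sval u); last exact: (svalP u).2.
split; first exact: (svalP u).1.
move=> nu Pnu unu A mA.
have mnu : setwise_le m nu.
  by move=> B mB; apply: le_trans ((svalP u).2 B mB) (unu B mB).
pose w : S := exist _ nu (conj Pnu mnu).
have /asboolP nuu := umax w (asboolT unu).
by apply/le_anti; rewrite (nuu A mA) (unu A mA).
Qed.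

Lemma maximal_effective_null_part m : P !=set0 -> maximal_effective_null P m ->
  exists2 nu, closed_convex_hull P nu & is_countably_additive_part nu m.
Proof.
move=> P0 [Pm mmax].
have [nu Cnu mnu] := effective_null_dominated P0 Pm.
exists nu => //.
(* The candidate for the purely finitely additive part is [nu - m]. *)
pose k A := ba_real nu A - fine (m A).
have kadd : finitely_additive k.
  move=> A B mA mB AB; rewrite /k ba_add//.
  have /= -> := measure_content_add m mA mB AB.
  ring.
have k0 A : measurable A -> 0 <= k A.
  by move=> mA; rewrite subr_ge0 fine_le ?fin_num_measure ?ba_fin// mnu.
have nuE A : measurable A -> nu A = (m A + (k A)%:E)%E.
  move=> mA; rewrite -[X in (X + _)%E]fineK ?fin_num_measure// -EFinD.
  by rewrite /k addrC subrK /ba_real /= fineK// ba_fin.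
exists (ba_of_content kadd k0); split => //.
move=> kappa kle A mA.
have [mk mkE] := finite_measure_add m kappa.
have mknu : setwise_le mk nu.
  by move=> B mB; rewrite mkE nuE// leeD2l// kle.
have mmk : setwise_le m mk by move=> B mB; rewrite mkE leeDl.
have := mmax _ (dominated_effective_null Cnu mknu) mmk A mA.
rewrite mkE -(fineK (fin_num_measure m _ mA)) -(fineK (fin_num_measure kappa _ mA)).
by rewrite -EFinD => -[H]; congr (_%:E); lra.
Qed.

(** From right to left, a countably additive part lies below its charge because the remainder is
    nonnegative, so [m] is dominated by an element of the closed convex hull. *)
Lemma effective_nullE : P !=set0 -> effective_null P =
  solid_hull (countably_additive_parts (closed_convex_hull P)).
Proof.
move=> P0; apply/seteqP; split => [m Pm|m [nu [eta Ceta [mu_p [mu_p0 _ etaE]]] mnu]].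
  have [m' m'max mm'] := effective_null_maximal Pm.
  have [nu Cnu num'] := maximal_effective_null_part P0 m'max.
  by exists m' => //; exists nu.
apply: (dominated_effective_null Ceta) => A mA.
by rewrite etaE//; apply: le_trans (mnu A mA) _; rewrite leeDl// mu_p0.
Qed.

End effective_null_theory.

Theorem theorem3p4 (d : measure_display) (Omega : measurableType d)
    (R : realType) (P : set (probability Omega R)) (P0 : P !=set0) :
  [/\ forall mu, effective_null P mu ->
        exists2 mu', maximal_effective_null P mu' & setwise_le mu mu',
      forall mu', maximal_effective_null P mu' ->
        exists2 mu'', closed_convex_hull P mu'' &
          is_countably_additive_part mu'' mu'
    & effective_null P =
        solid_hull (countably_additive_parts (closed_convex_hull P))].
Proof.
split; first by move=> mu; exact: effective_null_maximal.
  by move=> mu; exact: maximal_effective_null_part.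
exact: effective_nullE.
Qed.
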